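(* Let $\mathcal{T}^*$ be Tsirelson's space and let $0<p<\infty$. Then $\mathcal{CR}(\ell_p,\mathcal{T}^* )\le 4$.
   Context: For metric spaces $(M_1,d_1)$, $(M_2,d_2)$ and an arbitrary (not necessarily continuous) map $\phi: M_1\to M_2$, define for $t\in(0,\infty)$ $$\kappa_\phi(t)=\inf_{d_1(x,y)\ge t} d_2(\phi(x),\phi(y)),\qquad \omega_\phi(t)=\sup_{d_1(x,y)\le t} d_2(\phi(x),\phi(y)),$$ with values in $[0,\infty]$, and $\kappa(\phi)=\sup_{t<\infty}\kappa_\phi(t)$, $\omega(\phi)=\inf_{t>0}\omega_\phi(t)$. The separation ratio of $\phi$ is $\mathcal{R}(\phi)=\kappa(\phi)/\omega(\phi)\in[0,\infty]$, with the conventions $\frac{a}{\infty}=\frac{0}{a}=0$ for all $a\in[0,\infty]$ and $\frac{a}{0}=\frac{\infty}{a}=\frac{\infty}{0}=\infty$ for all $a\in(0,\infty)$. The coarse embeddability ratio is $\mathcal{CR}(M_1,M_2)=\sup_\phi \mathcal{R}(\phi)$, the supremum over all maps $\phi:M_1\to M_2$. Banach spaces carry their norm metric; for $0<p<1$ the same definitions are used for the quasi-Banach space $\ell_p$ with $d_1(x,y)=\|x-y\|_p=(\sum_n|x_n-y_n|^p)^{1/p}$. Tsirelson's space: A collection $\{I_1,\dots,I_m\}$ of disjoint intervals of natural numbers is admissible if $m<\min(I_k)$ for $1\le k\le m$. On the space $c_{00}$ of finitely supported real sequences put $\|x\|_0=\|x\|_{c_0}$ (the sup norm) and, for $n\in\mathbb{N}$,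 $$\|x\|_n=\max\Big\{\|x\|_{n-1},\ \sup\tfrac12\sum_{j=1}^m\|P_{I_j}x\|_{n-1}\Big\},$$ the supremum over all admissible families of intervals, where $P_{I}x$ is the projection of $x$ onto the coordinates in $I$. Set $\|x\|_{\mathcal{T}}=\sup_{n\ge0}\|x\|_n$, and let $\mathcal{T}$ be the completion of $c_{00}$ under $\|\cdot\|_{\mathcal{T}}$. Tsirelson's space $\mathcal{T}^*$ is the dual of $\mathcal{T}$. *)

(* Defs.v *)
From HB Require Import structures.
From mathcomp Require Import all_boot all_order all_algebra.
From mathcomp Require Import all_classical all_reals all_analysis.
Set Implicit Arguments.
Unset Strict Implicit.
Unset Printing Implicit Defensive.
Import Order.TTheory GRing.Theory Num.Theory.
Import numFieldNormedType.Exports.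
Local Open Scope classical_set_scope.
Local Open Scope ring_scope.

(** ** Coarse embeddability ratio *)

(* The distances are bare functions: for 0 < p < 1 the quasi-norm distance of
   l_p is not a metric.  An infimum over the empty set is +oo. *)
Section CoarseRatio.
Context {R : realType} {M1 M2 : Type}.
Variables (d1 : M1 -> M1 -> R) (d2 : M2 -> M2 -> R).
Implicit Types (phi : M1 -> M2) (t : R).
Local Open Scope ereal_scope.

Definition kappa_at phi t : \bar R :=
  ereal_inf [set (d2 (phi z.1) (phi z.2))%:E | z in [set z | (t <= d1 z.1 z.2)%R]].

Definition omega_at phi t : \bar R :=
  ereal_sup [set (d2 (phi z.1) (phi z.2))%:E | z in [set z | (d1 z.1 z.2 <= t)%R]].

Definition kappa phi : \bar R :=
  ereal_sup [set kappa_at phi t | t in [set t | (0 < t)%R]].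

Definition omega phi : \bar R :=
  ereal_inf [set omega_at phi t | t in [set t | (0 < t)%R]].

(* On [0, +oo], division in \bar R satisfies a / +oo = 0 / a = 0 for all a
   (including 0 / 0 = +oo / +oo = 0), and a / 0 = +oo / a = +oo / 0 = +oo for
   0 < a < +oo. *)
Definition separation_ratio phi : \bar R := kappa phi / omega phi.

Definition coarse_ratio : \bar R := ereal_sup (range separation_ratio).

End CoarseRatio.

(** ** The spaces l_p *)

Record lp (R : realType) (p : R) := Lp {
  lp_seq :> nat -> R;
  lp_summable : cvgn (series (fun n => `|lp_seq n| `^ p))
}.

Definition lp_dist (R : realType) (p : R) (x y : lp p) : R :=
  limn (series (fun n => `|x n - y n| `^ p)) `^ p^-1.

(** ** The space c_00 *)

Definition finsupp_pred (R : realType) : {pred nat -> R} :=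
  fun x => `[< exists N, forall n, (N <= n)%N -> x n = 0 >].

Lemma finsupp_submod_closed (R : realType) : submod_closed (@finsupp_pred R).
Proof.
split; first by apply/asboolP; exists 0%N.
move=> a x y /asboolP[N xN] /asboolP[M yM]; apply/asboolP.
exists (maxn N M) => n; rewrite geq_max => /andP[Nn Mn].
have -> : (a *: x + y) n = a * x n + y n by [].
by rewrite xN// yM// mulr0 addr0.
Qed.

HB.instance Definition _ (R : realType) :=
  GRing.isSubmodClosed.Build R (nat -> R) (@finsupp_pred R)
    (@finsupp_submod_closed R).

Record c00 (R : realType) := C00 {
  c00_seq :> nat -> R;
  c00_finsupp : c00_seq \in @finsupp_pred R
}.

HB.instance Definition _ (R : realType) := [isSub for @c00_seq R].
HB.instance Definition _ (R : realType) := [Choice of c00 R by <:].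
HB.instance Definition _ (R : realType) :=
  [SubChoice_isSubLmodule of c00 R by <:].

(** ** Tsirelson's norm on c_00 *)

Section Tsirelson.
Context {R : realType}.
Implicit Types (x y : nat -> R) (s : seq (nat * nat)) (I : nat * nat) (n : nat).

(* Natural numbers are 1, 2, 3, ... here: [x i] is the coordinate number
   [i.+1], and the pair I stands for the interval {I.1, ..., I.2}.  On c_00
   unbounded intervals yield nothing more than bounded ones. *)
Definition in_itv I i : bool := (I.1 <= i.+1 <= I.2)%N.

Definition proj_itv I x : nat -> R := fun i => if in_itv I i then x i else 0.

Definition admissible s : bool :=
  [&& all (fun I => I.1 <= I.2)%N s,
      pairwise (fun I J => (I.2 < J.1) || (J.2 < I.1))%N s
    & all (fun I => size s < I.1)%N s].

Local Open Scope ereal_scope.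

Fixpoint tnorm_ n x : \bar R :=
  match n with
  | 0%N => ereal_sup (range (fun i => `|x i|%:E))
  | n'.+1 =>
      maxe (tnorm_ n' x)
           (ereal_sup [set (2^-1)%:E * \sum_(I <- s) tnorm_ n' (proj_itv I x)
                      | s in [set s | admissible s]])
  end.

Definition tnorm x : \bar R := ereal_sup (range (tnorm_ ^~ x)).

Lemma tnorm__ge0 n x : 0 <= tnorm_ n x.
Proof.
elim: n => [|n IH] /=; last by rewrite le_max IH.
by apply: le_ereal_sup_tmp; exists `|x 0%N|%:E; [exists 0%N|rewrite lee_fin].
Qed.

Lemma proj_itvD I x y : proj_itv I (x \+ y)%R = (proj_itv I x \+ proj_itv I y)%R.
Proof. by apply/funext => i; rewrite /proj_itv/=; case: ifP; rewrite ?addr0. Qed.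

Lemma proj_itvZ I a x :
  proj_itv I (fun i => (a * x i)%R) = (fun i => (a * proj_itv I x i)%R).
Proof. by apply/funext => i; rewrite /proj_itv/=; case: ifP; rewrite ?mulr0. Qed.

Lemma tnorm_D n x y : tnorm_ n (x \+ y)%R <= tnorm_ n x + tnorm_ n y.
Proof.
elim: n x y => [|n IH] x y /=.
  apply: ge_ereal_sup => _ [i _ <-].
  apply: (@le_trans _ _ (`|x i|%:E + `|y i|%:E)).
    by rewrite -EFinD lee_fin ler_normD.
  by apply: leeD; apply: ereal_sup_ubound; exists i.
rewrite ge_max; apply/andP; split.
  by apply: (le_trans (IH x y)); apply: leeD; rewrite le_max lexx.
apply: ge_ereal_sup => _ [s sA <-].
apply: (@le_trans _ _
  ((2^-1)%:E * \sum_(I <- s) tnorm_ n (proj_itv I x) +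
   (2^-1)%:E * \sum_(I <- s) tnorm_ n (proj_itv I y))).
  rewrite -ge0_muleDr; [|by apply: sume_ge0 => *; exact: tnorm__ge0..].
  apply: lee_pmul => //; first by apply: sume_ge0 => *; exact: tnorm__ge0.
  by rewrite -big_split; apply: lee_sum => I _; rewrite proj_itvD.
by apply: leeD; rewrite le_max; apply/orP; right;
  apply: ereal_sup_ubound; exists s.
Qed.

Lemma tnorm_Z_le n (a : R) x :
  tnorm_ n (fun i => (a * x i)%R) <= `|a|%:E * tnorm_ n x.
Proof.
elim: n x => [|n IH] x /=.
  apply: ge_ereal_sup => _ [i _ <-].
  rewrite normrM EFinM; apply: lee_pmul => //.
  by apply: ereal_sup_ubound; exists i.
rewrite ge_max; apply/andP; split.
  by apply: (le_trans (IH x)); apply: lee_pmul => //;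
    rewrite ?tnorm__ge0// le_max lexx.
apply: ge_ereal_sup => _ [s sA <-].
apply: (@le_trans _ _
  (`|a|%:E * ((2^-1)%:E * \sum_(I <- s) tnorm_ n (proj_itv I x)))).
  rewrite muleCA; apply: lee_pmul => //.
    by apply: sume_ge0 => *; exact: tnorm__ge0.
  rewrite ge0_sume_distrr; last by move=> *; exact: tnorm__ge0.
  by apply: lee_sum => I _; rewrite proj_itvZ.
apply: lee_pmul => //.
  by apply: mule_ge0 => //; apply: sume_ge0 => *; exact: tnorm__ge0.
by rewrite le_max; apply/orP; right; apply: ereal_sup_ubound; exists s.
Qed.

Lemma admissible_count s i : admissible s -> (count (in_itv^~ i) s <= 1)%N.
Proof.
case/and3P => _ + _; elim: s => //= I s IH /andP[Is /IH].
case Ii: (in_itv I i) => //= _.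
rewrite (_ : count _ s = 0%N)//; apply/eqP; rewrite -leqn0 leqNgt -has_count.
apply/negP => /hasP[J Js]; move/allP: Is => /(_ J Js).
move: Ii; rewrite /in_itv => /andP[a b] /orP[c|c] /andP[d e].
  by have := leq_trans (leq_ltn_trans b c) d; rewrite ltnn.
by have := leq_trans (leq_ltn_trans e c) a; rewrite ltnn.
Qed.

Lemma tnorm__le_l1 n K x : (forall i, (K <= i)%N -> x i = 0%R) ->
  tnorm_ n x <= (\sum_(i < K) `|x i|)%:E.
Proof.
elim: n x => [|n IH] x xK /=.
  apply: ge_ereal_sup => _ [i _ <-]; rewrite lee_fin.
  have [iK|Ki] := ltnP i K; last by rewrite xK// normr0 sumr_ge0.
  by rewrite (bigD1 (Ordinal iK))//= lerDl sumr_ge0.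
rewrite ge_max IH//=; apply: ge_ereal_sup => _ [s sA <-].
apply: (@le_trans _ _ (\sum_(I <- s) (\sum_(i < K) `|proj_itv I x i|)%:E)).
  apply: (@le_trans _ _ (\sum_(I <- s) tnorm_ n (proj_itv I x))).
    rewrite -[leRHS]mul1e; apply: lee_pmul => //.
      by apply: sume_ge0 => *; exact: tnorm__ge0.
    by rewrite lee_fin invf_le1// ler1n.
  by apply: lee_sum => I _; apply: IH => i Ki; rewrite /proj_itv xK// if_same.
rewrite sumEFin lee_fin exchange_big/=; apply: ler_sum => i _.
rewrite (eq_bigr (fun I => if in_itv I i then `|x i| else 0)%R); last first.
  by move=> I _; rewrite /proj_itv; case: ifP; rewrite ?normr0.
rewrite -big_mkcond/= big_const_seq iter_addr_0.
by have := admissible_count i sA; case: (count _ _) => [|[|//]] _;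
  rewrite ?mulr0n ?mulr1n.
Qed.

Lemma tnorm_ge0 x : 0 <= tnorm x.
Proof.
by apply: le_ereal_sup_tmp; exists (tnorm_ 0 x); [exists 0%N|exact: tnorm__ge0].
Qed.

Lemma tnormD x y : tnorm (x \+ y)%R <= tnorm x + tnorm y.
Proof.
apply: ge_ereal_sup => _ [n _ <-]; apply: (le_trans (tnorm_D n x y)).
by apply: leeD; apply: ereal_sup_ubound; exists n.
Qed.

Lemma tnormZ_le (a : R) x : tnorm (fun i => (a * x i)%R) <= `|a|%:E * tnorm x.
Proof.
apply: ge_ereal_sup => _ [n _ <-]; apply: (le_trans (tnorm_Z_le n a x)).
apply: lee_pmul => //; first exact: tnorm__ge0.
by apply: ereal_sup_ubound; exists n.
Qed.

Lemma le_tnorm x i : `|x i|%:E <= tnorm x.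
Proof.
apply: (@le_trans _ _ (tnorm_ 0 x)); apply: ereal_sup_ubound; first by exists i.
by exists 0%N.
Qed.

Lemma tnorm_fin_num (x : c00 R) : tnorm x \is a fin_num.
Proof.
have /asboolP[K xK] := c00_finsupp x.
rewrite ge0_fin_numE ?tnorm_ge0//.
apply: (@le_lt_trans _ _ (\sum_(i < K) `|x i|)%:E); last exact: ltry.
by apply: ge_ereal_sup => _ [n _ <-]; exact: tnorm__le_l1.
Qed.

Definition c00_norm (x : c00 R) : R := fine (tnorm x).

Lemma c00_normD (x y : c00 R) :
  (c00_norm (x + y) <= c00_norm x + c00_norm y)%R.
Proof.
by rewrite -lee_fin EFinD !fineK ?tnorm_fin_num//; exact: tnormD.
Qed.

Lemma c00_normZ_le (a : R) (x : c00 R) :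
  (c00_norm (a *: x) <= `|a| * c00_norm x)%R.
Proof.
by rewrite -lee_fin EFinM !fineK ?tnorm_fin_num//; exact: tnormZ_le.
Qed.

Lemma c00_norm_eq0 (x : c00 R) : c00_norm x = 0%R -> x = 0%R.
Proof.
move=> x0; apply/val_inj/funext => i /=; apply/eqP; rewrite -normr_le0.
by rewrite -[leRHS]x0 -lee_fin fineK ?tnorm_fin_num// le_tnorm.
Qed.

Lemma c00_normZ (a : R) (x : c00 R) :
  c00_norm (a *: x) = (`|a| * c00_norm x)%R.
Proof.
have norm_ge0 (y : c00 R) : (0 <= c00_norm y)%R by exact/fine_ge0/tnorm_ge0.
have [->|a0] := eqVneq a 0%R.
  have := c00_normZ_le 0 x; rewrite normr0 mul0r => h.
  by apply/eqP; rewrite eq_le h norm_ge0.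
apply/eqP; rewrite eq_le c00_normZ_le/=.
rewrite mulrC -ler_pdivlMr ?normr_gt0// mulrC -normfV.
by rewrite -{1}[x](scalerK a0) c00_normZ_le.
Qed.

End Tsirelson.

HB.instance Definition _ (R : realType) := Lmodule_isNormed.Build R (c00 R)
  (@c00_normD R) (@c00_normZ R) (@c00_norm_eq0 R).

(** ** Completions and duals of normed spaces *)

Definition is_completion (R : realType) (V : normedModType R)
    (W : completeNormedModType R) (iota : {linear V -> W}) : Prop :=
  (forall x : V, `|iota x| = `|x|) /\ dense (range iota).

Record dual (R : realType) (V : normedModType R) := Dual {
  dual_fun :> {linear V -> R^o};
  dual_continuous : continuous dual_fun
}.

Definition op_norm (R : realType) (V : normedModType R) (f : V -> R) : R :=
  sup [set `|f x| | x in [set x | `|x| <= 1]].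

Definition dual_dist (R : realType) (V : normedModType R) (f g : dual V) : R :=
  op_norm (fun x => f x - g x).

(* Main.v *)
From HB Require Import structures.
Require Import Defs.
From mathcomp Require Import all_boot all_order all_algebra.
From mathcomp Require Import all_classical all_reals all_analysis.
From mathcomp Require Import ring lra zify.
Import Order.TTheory GRing.Theory Num.Theory.
Import numFieldNormedType.Exports.
Local Open Scope ring_scope.

(* Given phi : l_p -> T^* and s > 0, send a list u of naturals to
   a(u) = phi(c * sum_(i in u) e_i), with c such that replacing one entry of u
   moves the argument by at most s; thus replacing one entry moves a(u) by at
   most C = omega_phi(s). Iterated weak-* limits along a free ultrafilter write
   a(n_1, ..., n_k) as the iterated limit plus k increments of norm at most C,
   the j-th of which is weak-* null as n_j tends to infinity. The unit basis of
   T is shrinking, so for a fast growing choice of the n_j the increments are,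
   up to a small error, supported by successive intervals beyond k. These form
   an admissible family, and on such families the norm of T dominates half of
   the l_1 sum; hence a(n_1, ..., n_k) is within 2 C + e of the iterated limit.
   Two disjoint choices of indices are 4 C + 2 e apart, although their arguments
   are as far apart as desired when k is large. *)

(** * Tsirelson's norm and its implicit equation *)

Section TsirelsonNorm.
Context {R : realType}.
Implicit Types (x y : nat -> R) (s : seq (nat * nat)) (I J : nat * nat).
Local Open Scope ereal_scope.

Lemma proj_itvC I J x : proj_itv I (proj_itv J x) = proj_itv J (proj_itv I x).
Proof. by apply/funext => i; rewrite /proj_itv; do 2 case: ifP. Qed.

Lemma tnorm__proj n I x : tnorm_ n (proj_itv I x) <= tnorm_ n x.
Proof.
elim: n x => [|n IH] x /=.
  apply: ge_ereal_sup => _ [i _ <-]; rewrite /proj_itv; case: ifP => _.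
    by apply: ereal_sup_ubound; exists i.
  rewrite normr0; exact: (@tnorm__ge0 _ 0).
rewrite ge_max; apply/andP; split.
  by rewrite (le_trans (IH x))// le_max lexx.
apply: ge_ereal_sup => _ [s sA <-].
apply: (@le_trans _ _ ((2^-1)%:E * \sum_(J <- s) tnorm_ n (proj_itv J x))).
  apply: lee_pmul => //; first by apply: sume_ge0 => *; exact: tnorm__ge0.
  by apply: lee_sum => J _; rewrite proj_itvC.
by rewrite le_max; apply/orP; right; apply: ereal_sup_ubound; exists s.
Qed.

Lemma tnorm_proj I x : tnorm (proj_itv I x) <= tnorm x.
Proof.
apply: ge_ereal_sup => _ [n _ <-]; apply: (le_trans (tnorm__proj n I x)).
by apply: ereal_sup_ubound; exists n.
Qed.

Lemma cvg_tnorm x : (tnorm_ n x @[n --> \oo] --> tnorm x)%classic.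
Proof.
apply: ereal_nondecreasing_cvgn; apply/nondecreasing_seqP => n /=.
by rewrite le_max lexx.
Qed.

(** Stage [n.+1] dominates half the sum of the stage [n] norms; monotone convergence in [n] passes
    this on to the limit norm. *)
Lemma tnorm_admissible s x : admissible s ->
  (2^-1)%:E * \sum_(I <- s) tnorm (proj_itv I x) <= tnorm x.
Proof.
move=> sA.
have cvgs : ((2^-1)%:E * \sum_(I <- s) tnorm_ n (proj_itv I x) @[n --> \oo]
    --> (2^-1)%:E * \sum_(I <- s) tnorm (proj_itv I x))%classic.
  apply: cvgeZl => //; apply: cvg_nnesum => I _; last exact: cvg_tnorm.
  by apply: nearW => n; exact: tnorm__ge0.
rewrite -(cvg_lim _ cvgs)//; apply: lime_le.
  by apply/cvg_ex; eexists; exact: cvgs.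
apply: nearW => n.
apply: (@le_trans _ _ (tnorm_ n.+1 x)).
  by rewrite /= le_max; apply/orP; right; apply: ereal_sup_ubound; exists s.
by apply: ereal_sup_ubound; exists n.+1.
Qed.

(** Each stage is bounded by induction, since replacing the stage norms of the pieces by [tnorm]
    only enlarges the sums. *)
Lemma tnorm_le x (C : \bar R) : (forall i, `|x i|%:E <= C) ->
  (forall s, admissible s ->
    (2^-1)%:E * \sum_(I <- s) tnorm (proj_itv I x) <= C) -> tnorm x <= C.
Proof.
move=> xC sC; apply: ge_ereal_sup => _ [n _ <-].
elim: n => [|n IH] /=; first by apply: ge_ereal_sup => _ [i _ <-].
rewrite ge_max IH/=; apply: ge_ereal_sup => _ [s sA <-].
apply: le_trans (sC s sA); apply: lee_pmul => //.
  by apply: sume_ge0 => *; exact: tnorm__ge0.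
by apply: lee_sum => I _; apply: ereal_sup_ubound; exists n.
Qed.

End TsirelsonNorm.

(** * The real-valued norm and coordinate projections on [c00] *)

Section FinitelySupported.
Context {R : realType}.
Implicit Types (x y : c00 R) (s : seq (nat * nat)) (I J : nat * nat).

Lemma c00_eventually0 x : exists N, forall i, (N <= i)%N -> x i = 0.
Proof. by have /asboolP := c00_finsupp x. Qed.

Lemma c00P x y : (forall i, x i = y i) -> x = y.
Proof. by move=> xy; apply/val_inj/funext. Qed.

Lemma c00DE x y i : (x + y) i = x i + y i.
Proof. by []. Qed.

Lemma c00ZE (a : R) x i : (a *: x) i = a * x i.
Proof. by []. Qed.

Lemma c00_sumE (J : Type) (r : seq J) (P : pred J) (u : J -> c00 R) i :
  (\sum_(j <- r | P j) u j) i = \sum_(j <- r | P j) u j i.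
Proof. by elim/big_rec2 : _ => // j a b _ <-. Qed.

Lemma c00_normE x : (`|x|%:E = tnorm x)%E.
Proof. by rewrite fineK// tnorm_fin_num. Qed.

Lemma normr_coord_le x i : `|x i| <= `|x|.
Proof. by rewrite -lee_fin c00_normE le_tnorm. Qed.

Lemma finsupp_restrict (A : pred nat) x :
  (fun i => if A i then x i else 0) \in @finsupp_pred R.
Proof.
apply/asboolP; have [N xN] := c00_eventually0 x.
by exists N => i /xN ->; rewrite if_same.
Qed.

Definition cproj (A : pred nat) x : c00 R := C00 (finsupp_restrict A x).

Lemma cprojE A x i : cproj A x i = if A i then x i else 0.
Proof. by []. Qed.

Lemma cproj_is_linear A : linear (cproj A).
Proof.
move=> a x y; apply: c00P => i; rewrite c00DE c00ZE !cprojE c00DE c00ZE.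
by case: ifP => // _; rewrite mulr0 addr0.
Qed.

HB.instance Definition _ A :=
  GRing.isLinear.Build R (c00 R) (c00 R) _ (cproj A) (cproj_is_linear A).

Lemma norm_cproj_itv I x : `|cproj (Defs.in_itv I) x| <= `|x|.
Proof. by rewrite -lee_fin !c00_normE tnorm_proj. Qed.

(** A finitely supported tail is an interval projection; the interval starts at [N.+1] because index
    [i] is coordinate [i.+1]. *)
Lemma norm_cproj_ge N x : `|cproj (leq N) x| <= `|x|.
Proof.
have [K xK] := c00_eventually0 x.
suff -> : cproj (leq N) x = cproj (Defs.in_itv (N.+1, K)) x.
  exact: norm_cproj_itv.
apply: c00P => i /=; rewrite /Defs.in_itv/= ltnS; case: (leqP N i) => //= _.
by case: ltnP => // /xK.
Qed.

Lemma sum_norm_cproj s x : admissible s ->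
  \sum_(I <- s) `|cproj (Defs.in_itv I) x| <= 2 * `|x|.
Proof.
move=> sA; rewrite -ler_pdivrMl// -lee_fin EFinM -sumEFin c00_normE.
by under eq_bigr do rewrite c00_normE; exact: tnorm_admissible.
Qed.

Lemma c00_norm_le x (C : R) : (forall i, `|x i| <= C) ->
  (forall s, admissible s ->
    \sum_(I <- s) `|cproj (Defs.in_itv I) x| <= 2 * C) ->
  `|x| <= C.
Proof.
move=> xC sC; rewrite -lee_fin c00_normE; apply: tnorm_le => [i|s sA].
  by rewrite lee_fin.
have := sC s sA; rewrite -ler_pdivrMl// -lee_fin EFinM -sumEFin.
by under eq_bigr do rewrite c00_normE.
Qed.

End FinitelySupported.

(** * The unit basis is shrinking *)

Section Shrinking.
Context {R : realType}.
Implicit Types (x : c00 R) (s : seq (nat * nat)).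

(** The half-open intervals are disjoint. The induction needs the sharper bound [z <= b r], read as
    0 or 1. *)
Lemma sum_consecutive_le1 (b : nat -> nat) r z : {homo b : i j / (i <= j)%N} ->
  (\sum_(i < r) (b i < z <= b i.+1) <= 1)%N.
Proof.
move=> b_mono; apply: (@leq_trans (z <= b r)%N); last exact: leq_b1.
elim: r => [|r IH]; first by rewrite big_ord0.
rewrite big_ord_recr/=; case: (leqP z (b r)) IH => [zb|zb] IH.
  rewrite (leq_trans zb (b_mono _ _ (leqnSn r))).
  by rewrite addn0 (leq_trans IH)// leq_b1.
by move: IH; rewrite leqn0 => /eqP ->.
Qed.

(** An interval meeting the block contains its first index or starts inside it; with coordinates
    shifted by one, the latter reads [b < I.1 <= c]. *)
Lemma norm_cproj_block (I : nat * nat) x (b c : nat) :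
  (forall j, ~~ (b <= j < c)%N -> x j = 0) -> `|x| <= 1 ->
  `|cproj (Defs.in_itv I) x| <= (Defs.in_itv I b + (b < I.1 <= c))%:R.
Proof.
move=> xbc x1; case: (posnP (Defs.in_itv I b + (b < I.1 <= c))) => [|pos].
  move/eqP; rewrite addn_eq0 !eqb0 => /andP[Ib Ibc].
  suff -> : cproj (Defs.in_itv I) x = 0 by rewrite normr0.
  apply: c00P => j; rewrite cprojE [RHS](_ : _ = 0)//; case: ifP => // Ij.
  by apply: xbc; move: Ib Ibc Ij; rewrite /Defs.in_itv; lia.
by rewrite (le_trans (norm_cproj_itv _ _))// (le_trans x1)// ler1n.
Qed.

(* If a member of the admissible family s starts before M, then s has at most M
   members. A block meeting a member I either starts in I, which happens for at
   most one I, or contains the left endpoint of I, which happens for at most one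
   block. So the pieces of u_1, ..., u_r have norms of sum at most r + M. *)
Lemma norm_average_blocks (M r : nat) (b : nat -> nat) (u0 : c00 R)
    (u : nat -> c00 R) :
  (0 < r)%N -> (M <= b 0)%N -> {homo b : i j / (i <= j)%N} ->
  (forall j, (M <= j)%N -> u0 j = 0) -> `|u0| <= 1 ->
  (forall i j, ~~ (b i <= j < b i.+1)%N -> u i j = 0) ->
  (forall i, `|u i| <= 1) ->
  `|u0 + r%:R^-1 *: \sum_(i < r) u i| <= 3 / 2 + M%:R / r%:R.
Proof.
move=> r0 Mb b_mono u0M u01 ub u1.
have rR0 : 0 < r%:R :> R by rewrite ltr0n.
set v := _ *: _.
have v1 : `|v| <= 1.
  rewrite normrZ gtr0_norm ?invr_gt0// ler_pdivrMl// mulr1.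
  apply: le_trans (ler_norm_sum _ _ _) _.
  apply: (@le_trans _ _ (\sum_(i < r) 1)); first by apply: ler_sum.
  by rewrite sumr_const card_ord.
have bd1 : 1 <= 3 / 2 + M%:R / r%:R :> R.
  by have : 0 <= M%:R / r%:R :> R; [rewrite divr_ge0|lra].
apply: c00_norm_le => [j|s sA].
  rewrite c00DE; apply: le_trans bd1; case: (ltnP j M) => jM; last first.
    by rewrite u0M// add0r (le_trans (normr_coord_le _ _)).
  rewrite (_ : v j = 0) ?addr0 ?(le_trans (normr_coord_le _ _))//.
  rewrite c00ZE c00_sumE big1 ?mulr0// => i _; apply: ub.
  by have := b_mono 0%N i (leq0n i); lia.
(* If all members start beyond [M], they miss [u0] and only [v], of norm at most 1, contributes. *)
case: (altP (@allP _ (fun I => M < I.1)%N s)) => [sM|/allPn[I Is IM]].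
  rewrite (@le_trans _ _ (\sum_(I <- s) `|cproj (Defs.in_itv I) v|))//.
    rewrite big_seq [leRHS]big_seq; apply: ler_sum => I /sM/= MI.
    rewrite linearD/= (_ : cproj _ u0 = 0) ?add0r//; apply: c00P => j.
    rewrite cprojE [RHS](_ : _ = 0)//; case: ifP => // Ij.
    by apply: u0M; move: Ij; rewrite /Defs.in_itv; lia.
  apply: le_trans (sum_norm_cproj _ _ sA) _; rewrite ler_pM2l//.
  exact: le_trans v1 bd1.
have sM : (size s <= M)%N.
  by case/and3P: (sA) IM => _ _ /allP/(_ I Is) /=; lia.
have sv : \sum_(J <- s) `|cproj (Defs.in_itv J) v| <= 1 + M%:R / r%:R.
  rewrite (@le_trans _ _
    (r%:R^-1 * (\sum_(J <- s) \sum_(i < r)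
      (Defs.in_itv J (b i) + (b i < J.1 <= b i.+1)))%N%:R))//.
    rewrite natr_sum mulr_sumr; apply: ler_sum => J _.
    rewrite linearZ linear_sum/= normrZ gtr0_norm ?invr_gt0//.
    rewrite ler_pM2l ?invr_gt0// natr_sum; apply: le_trans (ler_norm_sum _ _ _) _.
    by apply: ler_sum => i _; exact: (norm_cproj_block _ _ _ _ (ub i) (u1 i)).
  rewrite ler_pdivrMl// mulrDr mulr1 mulrC divfK ?gt_eqF// -natrD ler_nat.
  under eq_bigr do rewrite big_split/=.
  rewrite big_split/= leq_add//.
    rewrite exchange_big/= -[leqRHS]muln1 -[X in (_ <= X * _)%N]card_ord.
    rewrite -sum_nat_const; apply: leq_sum => i _.
    rewrite (leq_trans _ (admissible_count (b i) sA))//.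
    rewrite -sum1_count [leqRHS]big_mkcond.
    by apply: leq_sum => J _; case: ifP.
  rewrite (leq_trans _ sM)// -sum1_size; apply: leq_sum => J _.
  exact: sum_consecutive_le1.
rewrite (@le_trans _ _ (\sum_(J <- s) `|cproj (Defs.in_itv J) u0| +
                        \sum_(J <- s) `|cproj (Defs.in_itv J) v|))//.
  by rewrite -big_split; apply: ler_sum => J _; rewrite linearD/= ler_normD.
(* The two sums are at most 2 and 1 + M / r; half of the total is below 3 / 2 + M / r. *)
have := sum_norm_cproj _ u0 sA.
have := ler0n R M; have : 0 <= M%:R / r%:R :> R by rewrite divr_ge0.
lra.
Qed.


(* Otherwise the norms of the tails of F decrease to some a > 0, and far out F
   almost attains a on normalised blocks u0, u_1, u_2, ... Then F is almost 2 a
   at u0 + (u_1 + ... + u_r) / r, whose norm is at most 8 / 5 for large r, while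
   F has norm at most about a far out. *)
Lemma shrinking (F : {linear c00 R -> R^o}) (C : R) :
  (forall x, `|F x| <= C * `|x|) -> forall e : R, 0 < e ->
  exists N, forall x, (forall i, (i < N)%N -> x i = 0) -> `|F x| <= e * `|x|.
Proof.
move=> FC e e0.
pose S := [set t : R | 0 <= t /\ exists N, forall x,
  (forall i, (i < N)%N -> x i = 0) -> `|F x| <= t * `|x|]%classic.
have S0 : S `|C|.
  split => //; exists 0%N => x _; apply: le_trans (FC x) _.
  by rewrite ler_wpM2r// ler_norm.
have lbS : lbound S 0 by move=> t [].
have infS : has_inf S by split; [exists `|C| | exists 0].
case: (ltP (inf S) e) => [Se|eS].
  have [|t [_ [N tN]]] := @inf_adherent _ S (e - inf S) _ infS; first by lra.
  rewrite addrC subrK => te; exists N => x xN; apply: le_trans (tN x xN) _.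
  by rewrite ler_wpM2r// ltW.
exfalso; set a := inf S in eS.
have a0 : 0 < a by exact: lt_le_trans eS.
have [|t [t0 [N tN]] ta] := @inf_adherent _ S (a / 100) _ infS; first by lra.
(* By minimality of [a], the constant [a - a / 100] fails on every tail; a witness is normalised,
   with its sign chosen to make [F] positive. *)
have block n : exists p : nat * c00 R, [/\ (n <= p.1)%N,
    forall j, ~~ (n <= j < p.1)%N -> p.2 j = 0, `|p.2| <= 1 &
    a - a / 100 <= F p.2].
  have : ~ S (a - a / 100).
    by move=> /(ge_inf (ex_intro _ 0 lbS)); rewrite -/a; lra.
  move=> /not_andP[|/forallNP/(_ n)/existsNP[x]]; first by lra.
  move=> /not_implyP[xn /negP]; rewrite -ltNge => Fx.
  have [K xK] := c00_eventually0 x.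
  have x0 : 0 < `|x|.
    rewrite normr_gt0; apply: contraTneq Fx => ->.
    by rewrite linear0 !normr0 mulr0 ltxx.
  pose c : R := Num.sg (F x : R) / `|x|; pose u : c00 R := c *: x.
  exists (maxn n K, u) => /=; split.
  - exact: leq_maxl.
  - move=> j nj; suff xj0 : x j = 0 by rewrite -[LHS]/(c * x j) xj0 mulr0.
    by case: (ltnP j n) => [/xn//|jn]; apply: xK; lia.
  - rewrite /u/c normrZ normrM normfV normr_id divfK ?gt_eqF// normr_sg.
    by rewrite lern1 leq_b1.
  - rewrite /u [F _]linearZ/= -[leRHS]/(c * F x : R) /c mulrAC -normrEsg.
    by rewrite ler_pdivlMr// ltW.
have [f fP] := choice block.
pose b i := iter i (fun n => (f n).1) (f N).1.
have bS i : b i.+1 = (f (b i)).1 by [].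
have b_mono : {homo b : i j / (i <= j)%N}.
  by apply: homo_leq => // [? ? ?|i]; [exact: leq_trans|case: (fP (b i))].
have N_b i : (N <= b i)%N.
  by case: (fP N) => Nf _ _ _; apply: leq_trans Nf (b_mono 0%N i (leq0n i)).
(* This [r] makes M / r at most 1 / 10, so [z] has norm at most 8 / 5. *)
pose M := b 0%N; pose r := (10 * M.+1)%N.
have rR0 : 0 < r%:R :> R by rewrite ltr0n.
pose z := (f N).2 + r%:R^-1 *: \sum_(i < r) (f (b i)).2.
have zle : `|z| <= 3 / 2 + M%:R / r%:R.
  case: (fP N) => Nf fN0 fN1 _.
  apply: (norm_average_blocks M r b _ (fun i => (f (b i)).2)) => //.
  - by move=> j jM; apply: fN0; move: jM; rewrite /M/b/=; lia.
  - by move=> i j; case: (fP (b i)) => _ + _ _; apply.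
  - by move=> i; case: (fP (b i)).
have Mr : M%:R / r%:R <= 1 / 10 :> R.
  rewrite ler_pdivrMr// /r natrM -[M.+1%:R]natr1; have := ler0n R M; lra.
have zN i : (i < N)%N -> z i = 0.
  move=> iN; rewrite c00DE c00ZE c00_sumE.
  rewrite (_ : (f N).2 i = 0); last first.
    by case: (fP N) => _ + _ _; apply; rewrite negb_and -ltnNge iN.
  rewrite big1 ?mulr0 ?addr0// => j _.
  by case: (fP (b j)) => _ + _ _; apply; have := N_b j; lia.
have Fz : 2 * (a - a / 100) <= F z.
  rewrite linearD [F (_ *: _)]linearZ/= [F (\sum_(_ < _) _)]linear_sum/=.
  rewrite mulr_natl mulr2n lerD//.
    by case: (fP N).
  rewrite -[leRHS]/(r%:R^-1 * (\sum_(i < r) (F (f (b i)).2 : R))) ler_pdivlMl//.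
  rewrite mulrC mulr_natr -[X in _ *+ X]card_ord -sumr_const; apply: ler_sum.
  by move=> i _; case: (fP (b i)).
(* As [z] vanishes before [N], the constant [t < 1.01 a] applies to it and gives less than 1.616 a,
   against the lower bound 1.98 a. *)
have := tN z zN; rewrite leNgt => /negP; apply.
apply: lt_le_trans (ler_norm _); apply: lt_le_trans Fz.
apply: (@le_lt_trans _ _ ((a + a / 100) * (8 / 5))); last by lra.
by rewrite ler_pM// ?(ltW ta)//; lra.
Qed.

End Shrinking.

(** * Iterated ultrafilter limits and approximation by blocks *)

Section IteratedLimits.
Context {R : realType} (U : set_system nat).
Context {UU : UltraFilter U}.
Local Open Scope classical_set_scope.
Local Open Scope ring_scope.
Implicit Types (x : c00 R) (s t : seq nat) (Is : seq (nat * nat)).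

(** By compactness the image ultrafilter has a cluster point, and an ultrafilter converges to its
    cluster points. *)
Lemma cvg_ultra_bounded (g : nat -> R) (m C : R) :
  (forall n, `|g n - m| <= C) -> cvg (g n @[n --> U]).
Proof.
move=> gC; have [|l [_ gl]] := @segment_compact R (m - C) (m + C) (g @ U) _.
  by apply: (@filterE _ U) => n /=; rewrite in_itv/= -ler_distlC distrC.
apply/(@cvg_ex R); exists l => A Al.
case: (in_ultra_setVsetC (g @^-1` A) UU) => //.
by move=> gA; have [_ [/[apply]]] := gl (~` A) A gA Al.
Qed.

(** [d] counts the entries still to be appended to [s]; the limit over the last entry is
    innermost. *)
Fixpoint iterated_lim (a : seq nat -> c00 R -> R) d s x : R :=
  if d is d'.+1 then lim (iterated_lim a d' (rcons s n) x @[n --> U])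
  else a s x.

Variables (a : seq nat -> {linear c00 R -> R^o}) (C : R).
Hypothesis a_lip : forall s n m t x,
  `|a (s ++ n :: t) x - a (s ++ m :: t) x| <= C * `|x|.

Lemma iterated_lim_lip d s n m t x :
  `|iterated_lim a d (s ++ n :: t) x - iterated_lim a d (s ++ m :: t) x|
    <= C * `|x|.
Proof.
elim: d s n m t x => [|d IH] s n m t x /=; first exact: a_lip.
(* Convergence comes from the bound itself: by induction, all values lie within a fixed distance of
   the one at entry 0. *)
have cvgd r : cvg (iterated_lim a d (rcons r k) x @[k --> U]).
  apply: (@cvg_ultra_bounded _ (iterated_lim a d (rcons r 0%N) x) (C * `|x|)).
  by move=> k; rewrite -!cats1.
rewrite -limB//; set h := (X in lim (X @ U)).
have hC k : `|h k| <= C * `|x|.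
  by have := IH s n m (rcons t k) x; rewrite -!rcons_cons -!rcons_cat.
have cvgh : cvg (h @ U) by apply: is_cvgB.
rewrite ler_norml; apply/andP; split.
  apply: limr_ge => //; apply: nearW => k.
  by have := hC k; rewrite ler_norml => /andP[].
apply: limr_le => //; apply: nearW => k.
by have := hC k; rewrite ler_norml => /andP[].
Qed.

Lemma is_cvg_iterated_lim d s x :
  cvg (iterated_lim a d (rcons s n) x @[n --> U]).
Proof.
apply: (@cvg_ultra_bounded _ (iterated_lim a d (rcons s 0%N) x) (C * `|x|)).
by move=> n; rewrite -!cats1 iterated_lim_lip.
Qed.

Lemma iterated_lim_linear d s : linear (iterated_lim a d s : c00 R -> R^o).
Proof.
elim: d s => [|d IH] s c x y /=; first by rewrite linearP.
under eq_fun do rewrite IH.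
have cvgd z := @is_cvg_iterated_lim d s z.
have cvgc : cvg (c *: (iterated_lim a d (rcons s n) x : R^o) @[n --> U]).
  exact: is_cvgZr.
by rewrite limD// limZr.
Qed.

HB.instance Definition _ d s := GRing.isLinear.Build R (c00 R) R^o _
  (iterated_lim a d s) (iterated_lim_linear d s).

Lemma iterated_lim_near d s x (e : R) : 0 < e ->
  \forall n \near U,
    `|iterated_lim a d (rcons s n) x - iterated_lim a d.+1 s x| <= e.
Proof.
move=> e0; have /cvgrPdist_le/(_ e e0) := is_cvg_iterated_lim d s x.
by apply: filterS => n; rewrite distrC.
Qed.

Lemma iterated_lim_step d s n x :
  `|iterated_lim a d (rcons s n) x - iterated_lim a d.+1 s x| <= C * `|x|.
Proof.
apply/ler_addgt0Pr => e /(iterated_lim_near d s x) /filter_ex[m me].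
apply: le_trans (ler_distD (iterated_lim a d (rcons s m) x) _ _) _.
by rewrite lerD// -!cats1 iterated_lim_lip.
Qed.

Let incr d s n : {linear c00 R -> R^o} :=
  iterated_lim a d (rcons s n) \- iterated_lim a d.+1 s.

Let incrE d s n x :
  incr d s n x = iterated_lim a d (rcons s n) x - iterated_lim a d.+1 s x.
Proof. by []. Qed.

(** Pointwise convergence is uniform in finite dimension: coordinates are added one at a time, each
    at the cost of half of [e]. *)
Lemma iterated_lim_near_head d s N (e : R) : 0 < e ->
  \forall n \near U, forall x, (forall i, (N <= i)%N -> x i = 0) ->
    `|incr d s n x| <= e * `|x|.
Proof.
elim: N e => [|N IH] e e0.
  apply: nearW => n x x0.
  rewrite (_ : x = 0) ?linear0 ?normr0 ?mulr0//.
  by apply: c00P => i; rewrite x0.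
have finN : (fun i => (i == N)%:R) \in @finsupp_pred R.
  apply/asboolP; exists N.+1 => i; rewrite ltnNge.
  by case: eqVneq => // ->; rewrite leqnn.
have e20 : 0 < e / 2 by rewrite divr_gt0.
have := iterated_lim_near d s (C00 finN) (e / 2) e20.
apply: filterS2 (IH (e / 2) e20) => n nIH nN x xN.
set y := cproj (Defs.in_itv (1%N, N)) x.
have xE : x = y + x N *: C00 finN.
  apply: c00P => i; rewrite c00DE c00ZE cprojE/= /Defs.in_itv/=.
  case: (ltngtP i N) => [||->]; rewrite ?mulr0 ?addr0 ?mulr1 ?add0r//.
  exact: xN.
rewrite [in leLHS]xE linearD linearZ.
apply: le_trans (ler_normD _ _) _; rewrite [e in leRHS]splitr mulrDl lerD//.
  apply: le_trans (nIH y _) _.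
    by move=> i Ni; rewrite cprojE /Defs.in_itv/= ltnNge Ni.
  by rewrite ler_wpM2l ?norm_cproj_itv// ltW.
by rewrite normrZ mulrC ler_pM// normr_coord_le.
Qed.

(** In the induction, [N] pushes new intervals beyond the old ones and [B] makes the entries of [t]
    increase. Each increment costs [e] off its own interval. *)
Lemma block_approximation (e : R) : 0 < e -> (\oo `<=` U) ->
  forall d s N B, exists t Is,
  [/\ size t = d, uniq t & all (leq B) t] /\
  [/\ size Is = d, all (fun I => I.1 <= I.2)%N Is,
      pairwise (fun I J => (I.2 < J.1) || (J.2 < I.1))%N Is,
      all (fun I => N < I.1)%N Is &
      forall x, `|a (s ++ t) x - iterated_lim a d s x| <=
        C * \sum_(I <- Is) `|cproj (Defs.in_itv I) x| + d%:R * e * `|x|].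
Proof.
move=> e0 UF; elim=> [|d IH] s N B.
  exists [::], [::]; split; split => // x /=.
  by rewrite cats0 subrr normr0 big_nil !mulr0 !mul0r addr0.
have e20 : 0 < e / 2 by rewrite divr_gt0.
have [n [nN Bn]] : exists n, (forall x, (forall i, (N <= i)%N -> x i = 0) ->
    `|incr d s n x| <= e / 2 * `|x|) /\ (B <= n)%N.
  apply: (@filter_ex _ U); near=> n; split; near: n.
    exact: iterated_lim_near_head.
  by apply: UF; exact: nbhs_infty_ge.
have incrC x : `|incr d s n x| <= C * `|x| by exact: iterated_lim_step.
have incrD x y : incr d s n (x + y) = incr d s n x + incr d s n y.
  exact: linearD.
have [K KP] := shrinking _ C incrC _ e20.
(* [N.+1] keeps the interval non-empty, as admissibility demands; [K] makes the tail beyond it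
   negligible. *)
pose N' := maxn N.+1 K; pose I := (N.+1, N').
have [t [Is [[st ut Bt] [sIs vIs pIs NIs aIs]]]] := IH (rcons s n) N' n.+1.
exists (n :: t), (I :: Is); split; split => /=.
- by rewrite st.
- rewrite ut andbT; apply/negP => /(allP Bt); rewrite ltnn//.
- by rewrite Bn/=; apply: sub_all Bt => m /ltnW; exact: leq_trans.
- by rewrite sIs.
- by rewrite vIs leq_maxl.
- by rewrite pIs andbT; apply: sub_all NIs => J ->.
- by rewrite ltnSn; apply: sub_all NIs => J; apply: ltn_trans; exact: leq_maxl.
move=> x; rewrite big_cons -cat_rcons.
rewrite (_ : _ - _ = (a (rcons s n ++ t) x - iterated_lim a d (rcons s n) x) +
  incr d s n x); last by rewrite incrE addrA subrK.
apply: le_trans (ler_normD _ _) _.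
have xE : x = cproj (Defs.in_itv (1%N, N)) x + cproj (Defs.in_itv I) x +
    cproj (leq N') x.
  apply: c00P => i; rewrite !c00DE !cprojE /Defs.in_itv/= !ltnS.
  case: (ltnP i N) => iN; case: (ltnP i N') => iN'; rewrite ?addr0 ?add0r//.
  by move: iN'; rewrite /N'; lia.
have {xE} yx : `|incr d s n x| <= e * `|x| + C * `|cproj (Defs.in_itv I) x|.
  have head : `|incr d s n (cproj (Defs.in_itv (1%N, N)) x)| <= e / 2 * `|x|.
    apply: le_trans (nN _ _) _.
      by move=> i Ni; rewrite cprojE /Defs.in_itv/= ltnNge Ni.
    by rewrite ler_wpM2l ?norm_cproj_itv// ltW.
  have tail : `|incr d s n (cproj (leq N') x)| <= e / 2 * `|x|.
    apply: le_trans (KP _ _) _.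
      by move=> i iK; rewrite cprojE leqNgt (leq_trans iK)// leq_maxr.
    by rewrite ler_wpM2l ?norm_cproj_ge// ltW.
  rewrite [in leLHS]xE 2!incrD.
  apply: le_trans (ler_normD _ _) _; rewrite [e in leRHS]splitr mulrDl.
  rewrite [leRHS]addrAC lerD//; apply: le_trans (ler_normD _ _) _; exact: lerD.
apply: le_trans (lerD (aIs x) yx) _.
by rewrite -natr1 !mulrDl mulrDr mul1r; lra.
Unshelve. all: by end_near. Qed.

End IteratedLimits.

(** Both lists are compared with one iterated limit; the second starts beyond all entries of the
    first. *)
Lemma far_pair {R : realType} (a : seq nat -> {linear c00 R -> R^o}) (C : R) :
  0 <= C ->
  (forall s n m t x, `|a (s ++ n :: t) x - a (s ++ m :: t) x| <= C * `|x|) ->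
  forall (k : nat) (e : R), 0 < e ->
  exists t t', [/\ size t = k, size t' = k, uniq (t ++ t') &
    forall x, `|a t x - a t' x| <= (4 * C + e) * `|x|].
Proof.
move=> C0 a_lip k e e0.
have [U [UU UF]] := ultraFilterLemma eventually_filter.
have k0 : 0 < k.+1%:R :> R by rewrite ltr0n.
pose e' := e / (2 * k.+1%:R).
have e'0 : 0 < e' by rewrite divr_gt0// mulr_gt0.
have ek : 2 * (k%:R * e') <= e.
  have -> : 2 * (k%:R * e') = e * (k%:R / k.+1%:R).
    by rewrite /e'; field; rewrite gt_eqF.
  by rewrite ler_piMr ?(ltW e0)// ler_pdivrMr// mul1r ler_nat.
have approx B : exists t, [/\ size t = k, uniq t, all (leq B) t &
    forall x, `|a t x - iterated_lim U a k [::] x| <=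
      (2 * C + k%:R * e') * `|x|].
  have [t [Is [[st ut Bt] [sIs vIs pIs kIs aIs]]]] :=
    block_approximation U a C a_lip e' e'0 UF k [::] k B.
  (* The [k] intervals all start beyond [k], so they are admissible and the pieces of [x] sum to at
     most twice its norm. *)
  exists t; split => // x; apply: le_trans (aIs x) _.
  rewrite mulrDl lerD2r -mulrA mulrCA ler_wpM2l//; apply: sum_norm_cproj.
  by rewrite /admissible vIs pIs sIs.
have [t [st ut _ ta]] := approx 0%N.
have [t' [st' ut' Bt' t'a]] := approx (\max_(i <- t) i).+1.
exists t, t'; split => //.
  rewrite cat_uniq ut ut' andbT/=; apply/hasPn => i /(allP Bt').
  by apply: contraL => it; rewrite -leqNgt; apply: leq_bigmax_seq.
move=> x; apply: le_trans (ler_distD (iterated_lim U a k [::] x) _ _) _.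
rewrite [X in _ + X]distrC (le_trans (lerD (ta x) (t'a x)))// -mulrDl.
by rewrite ler_wpM2r//; lra.
Qed.

(** * Operator norms and dense subspaces *)

Section OperatorNorm.
Context {R : realType} {V : normedModType R}.
Local Open Scope classical_set_scope.
Local Open Scope ring_scope.

(** Continuity bounds the set under the supremum; without a bound, [sup] would take its default
    value 0. *)
Lemma le_op_norm (f : {linear V -> R^o}) (v : V) : continuous f ->
  `|f v| <= op_norm f * `|v|.
Proof.
move=> /(_ 0) /(@continuous_linear_bounded _ _ _ 0 f)/linear_boundedP.
move=> /filter_ex[r fr].
have [->|v0] := eqVneq v 0; first by rewrite linear0 !normr0 mulr0.
have v1 : 0 < `|v| by rewrite normr_gt0.
rewrite -ler_pdivrMr//; apply: sup_upper_bound.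
  split; first by exists `|f 0|; exists 0; rewrite /= ?normr0.
  exists `|r| => _ [w /= w1 <-]; apply: le_trans (fr w) _.
  rewrite (le_trans (ler_norm _))// normrM normr_id ler_piMr//.
exists (`|v|^-1 *: v) => /=.
  by rewrite normrZ normfV normr_id mulVf// gt_eqF.
by rewrite linearZ normrZ normfV normr_id mulrC.
Qed.

Lemma op_norm_ge0 (f : V -> R) : 0 <= op_norm f.
Proof.
rewrite /op_norm; set E := (X in sup X).
have [supE|/sup_out ->//] := pselect (has_sup E).
apply: le_trans (normr_ge0 (f 0)) _; apply: sup_upper_bound => //.
by exists 0; rewrite /= ?normr0.
Qed.

(** If the bound failed at one point, it would fail on an open set, which meets the dense image of
    [j]. *)
Lemma op_norm_le (W : normedModType R) (j : W -> V) (f : V -> R) (C : R) :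
  0 <= C -> continuous (f : V -> R^o) -> (forall w, `|j w| = `|w|) ->
  dense (range j) -> (forall w, `|f (j w)| <= C * `|w|) -> op_norm f <= C.
Proof.
move=> C0 f_cont j_iso j_dense fC.
have fV v : `|f v| <= C * `|v|.
  rewrite leNgt; apply/negP => Cv.
  pose g u : R := `|f u| - C * `|u|.
  have g_cont : continuous g.
    move=> u; apply: cvgB; first exact: (cvg_norm (f_cont u)).
    by apply: cvgMr; exact: norm_continuous.
  have [||y [gy [w _ wy]]] := j_dense (g @^-1` [set r | 0 < r]).
  - by exists v; rewrite /g/= subr_gt0.
  - by apply: open_comp; [move=> u _; exact: g_cont|exact: open_gt].
  - by move: gy; rewrite -wy /g/= subr_gt0 ltNge j_iso fC.
apply: ge_sup; first by exists `|f 0|; exists 0; rewrite /= ?normr0.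
move=> _ [v /= v1 <-]; apply: le_trans (fV v) _.
by rewrite ler_piMr.
Qed.

End OperatorNorm.

(** * Finitely supported points of l_p given by lists *)

Section LpCounting.
Context {R : realType} (p : R) (p_gt0 : 0 < p).
Local Open Scope classical_set_scope.
Local Open Scope ring_scope.
Implicit Types (u : seq nat) (c : R).

Lemma sum_count_mem u n : all (fun i => i < n)%N u ->
  (\sum_(0 <= i < n) count_mem i u = size u)%N.
Proof.
elim: u => [|j u IH] /=; first by rewrite big1.
move=> /andP[jn /IH]; rewrite big_split/= => ->.
rewrite (bigD1_seq j) ?mem_index_iota ?iota_uniq//= eqxx big1 ?addn0//.
by move=> i ij; rewrite eq_sym (negbTE ij).
Qed.

Lemma cvg_series_count c u :
  series (fun i => c * (count_mem i u)%:R) n @[n --> \oo] --> c * (size u)%:R.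
Proof.
apply: cvg_near_cst; near=> n.
rewrite /series/= -mulr_sumr -natr_sum sum_count_mem//.
near: n; exists (\max_(i <- u) i).+1 => // n /= un; apply/allP => i iu.
by apply: leq_trans un; rewrite ltnS; apply: leq_bigmax_seq.
Unshelve. all: by end_near. Qed.

Lemma is_cvg_series_eventually0 (f : nat -> R) N :
  (forall i, (N <= i)%N -> f i = 0) -> cvgn (series f).
Proof.
move=> f0; apply: (@is_cvg_near_cst _ _ (series f N)).
exists N => // n /= Nn; rewrite /series/= (big_cat_nat (leq0n N) Nn)//=.
rewrite [X in _ + X](_ : _ = 0) ?addr0// big_nat big1//.
by move=> i /andP[/f0].
Qed.

Lemma lp_point_summable c u :
  cvgn (series (fun i => `|c * (count_mem i u)%:R| `^ p)).
Proof.
apply: (@is_cvg_series_eventually0 _ (\max_(i <- u) i).+1) => i ui.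
rewrite (_ : count_mem i u = 0%N) ?mulr0 ?normr0 ?powR0 ?gt_eqF//.
apply/count_memPn/negP => iu; move: ui.
by apply/negP; rewrite -ltnNge ltnS; apply: leq_bigmax_seq.
Qed.

(** The sequence, inferred from the summability proof, is [c] times the multiplicity of each index
    in [u]. *)
Definition lp_point c u : lp p := Lp (lp_point_summable c u).

Lemma lp_dist_count c u (x y : lp p) :
  (forall i, `|x i - y i| `^ p = c * (count_mem i u)%:R) ->
  lp_dist x y = (c * (size u)%:R) `^ p^-1.
Proof.
move=> xy; rewrite /lp_dist.
rewrite (_ : (fun n => _) = fun i => c * (count_mem i u)%:R).
  by rewrite (cvg_lim _ (@cvg_series_count c u)).
by apply/funext.
Qed.

End LpCounting.

(** * Distances after a swap and between disjoint lists *)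

Section LpGeometry.
Context {R : realType} (p : R) (p_gt0 : 0 < p).
Implicit Types (u s t : seq nat) (c r : R).

(* The scale is such that replacing one entry of u moves the point by r. *)
Definition swap_point r u : lp p := lp_point p p_gt0 ((r `^ p / 2) `^ p^-1) u.

Let scaleE r : 0 < r -> `|(r `^ p / 2) `^ p^-1| `^ p = r `^ p / 2.
Proof.
move=> r0; rewrite ger0_norm ?powR_ge0// -powRrM mulVf ?gt_eqF// powRr1//.
by rewrite divr_ge0// powR_ge0.
Qed.

(** For [n != m] the multiplicities differ by 1 at [n] and [m] only, and each contributes half of
    the p-th power of [r]. *)
Lemma swap_point_dist_le r s t n m : 0 < r ->
  lp_dist (swap_point r (s ++ n :: t)) (swap_point r (s ++ m :: t)) <= r.
Proof.
move=> r0.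
rewrite (@lp_dist_count _ _ (r `^ p / 2) (if n == m then [::] else [:: n; m])).
  apply: (@le_trans _ _ ((r `^ p) `^ p^-1)); last first.
    by rewrite -powRrM mulfV ?gt_eqF// powRr1// ltW.
  apply: ge0_ler_powR; rewrite ?nnegrE ?invr_ge0 ?(ltW p_gt0)//.
  - by rewrite mulr_ge0// divr_ge0// powR_ge0.
  - exact: powR_ge0.
  - rewrite -mulrA ler_piMr ?powR_ge0// ler_pdivrMl// mulr1.
    by case: ifP => _; rewrite /= ?ler_nat.
move=> i; rewrite /= !count_cat/= -mulrBr normrM.
rewrite (powRM p (normr_ge0 _) (normr_ge0 _)) scaleE//; congr *%R.
rewrite [X in `|X|](_ : _ = (n == i)%:R - (m == i)%:R); last first.
  by rewrite !natrD; ring.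
have [<-|nm] := eqVneq n m; first by rewrite subrr normr0 powR0 ?gt_eqF.
rewrite /= addn0; case: (eqVneq n i) => [ni|_].
  by rewrite -ni [m == n]eq_sym (negbTE nm) subr0 normr1 powR1.
rewrite sub0r normrN; case: eqP; rewrite ?normr1 ?powR1//.
by rewrite normr0 powR0 ?gt_eqF.
Qed.

Lemma swap_point_dist_disjoint r t t' : 0 < r -> uniq (t ++ t') ->
  lp_dist (swap_point r t) (swap_point r t') =
    (r `^ p * ((size t + size t')%:R / 2)) `^ p^-1.
Proof.
move=> r0 utt'; rewrite (@lp_dist_count _ _ (r `^ p / 2) (t ++ t')).
  by rewrite size_cat mulrAC mulrA.
move=> i; rewrite /= -mulrBr normrM.
rewrite (powRM p (normr_ge0 _) (normr_ge0 _)) scaleE//; congr *%R.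
move: utt'; rewrite count_cat cat_uniq => /and3P[ut tt' ut'].
rewrite !count_uniq_mem//; case: (boolP (i \in t)) => it /=.
  rewrite (_ : i \in t' = false) ?subr0 ?normr1 ?powR1//.
  by apply: contraNF tt' => it'; apply/hasP; exists i.
rewrite sub0r normrN; case: (i \in t'); rewrite ?normr1 ?powR1//.
by rewrite normr0 powR0 ?gt_eqF.
Qed.

End LpGeometry.

(** * Comparison of [kappa] with [omega] *)

Theorem proposition4p9 (R : realType) (T : completeNormedModType R)
    (iota : {linear c00 R -> T}) (T_completion : is_completion iota)
    (p : R) (p_gt0 : 0 < p) :
  (coarse_ratio (@lp_dist R p) (@dual_dist R T) <= 4%:E)%E.
Proof.
have [iota_iso iota_dense] := T_completion.
apply: ge_ereal_sup => _ [phi _ <-].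
have dual_cont (f g : dual T) : continuous (f \- g : T -> R^o).
  move=> v.
  exact: continuousB (@dual_continuous _ _ f v) (@dual_continuous _ _ g v).
have kappa_omega r s : 0 < s ->
  (kappa_at (@lp_dist R p) (@dual_dist R T) phi r <=
   4%:E * omega_at (@lp_dist R p) (@dual_dist R T) phi s)%E.
  move=> s0; set om := omega_at _ _ _ _.
  pose pt := swap_point p p_gt0 s.
  have om_ge u v n m :
    ((dual_dist (phi (pt (u ++ n :: v))) (phi (pt (u ++ m :: v))))%:E
      <= om)%E.
    apply: ereal_sup_ubound; exists (pt (u ++ n :: v), pt (u ++ m :: v)) => //=.
    exact: swap_point_dist_le.
  have om_ge0 : (0 <= om)%E.
    by apply: le_trans (om_ge [::] [::] 0%N 0%N); rewrite lee_fin op_norm_ge0.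
  case: om om_ge om_ge0 => [C om_ge C0|_ _|//]; last first.
    by rewrite gt0_muley ?leey// lte_fin.
  pose a u : {linear c00 R -> R^o} := phi (pt u) \o iota.
  have a_lip u n m v x : `|a (u ++ n :: v) x - a (u ++ m :: v) x| <= C * `|x|.
    have := @le_op_norm _ _ (phi (pt (u ++ n :: v)) \- phi (pt (u ++ m :: v)))
      (iota x) (dual_cont _ _).
    move=> /le_trans; apply; rewrite iota_iso ler_wpM2r//.
    by have := om_ge u v n m; rewrite lee_fin.
  apply/lee_addgt0Pr => e e0.
  have p_neq0 : p != 0 by rewrite gt_eqF.
  have sp0 : 0 < s `^ p by rewrite powR_gt0.
  (* The two points will be at distance [s] times the p-th root of [k], hence at least [r]. *)
  pose k := Num.bound (`|r| `^ p / s `^ p).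
  have C0' : 0 <= C by rewrite -lee_fin.
  have [t [t' [tk t'k utt' tt']]] := far_pair a C C0' a_lip k e e0.
  apply: (@le_trans _ _ (dual_dist (phi (pt t)) (phi (pt t')))%:E).
    apply: ereal_inf_lbound; exists (pt t, pt t') => //=.
    rewrite swap_point_dist_disjoint// tk t'k addnn -muln2 natrM mulfK//.
    apply: le_trans (ler_norm r) _.
    rewrite -[leLHS]powRr1// -[in leLHS](mulfV p_neq0) powRrM.
    apply: ge0_ler_powR; rewrite ?nnegrE ?invr_ge0 ?(ltW p_gt0) ?powR_ge0//.
      by rewrite mulr_ge0 ?powR_ge0.
    by rewrite -ler_pdivrMl// mulrC ltW// archi_boundP// divr_ge0// powR_ge0.
  rewrite -EFinM -EFinD lee_fin; apply: (op_norm_le _ iota) => //.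
    by rewrite addr_ge0 ?mulr_ge0// ltW.
  exact: dual_cont.
rewrite /separation_ratio; set ka := kappa _ _ _; set om := omega _ _ _.
have ka_om : (ka <= 4%:E * om)%E.
  apply: ge_ereal_sup => _ [r _ <-]; rewrite /om/omega -ereal_inf_pZl//.
  by apply: le_ereal_inf_tmp => _ [_ [s s0 <-] <-]; exact: kappa_omega.
have : (0 <= om)%E.
  apply: le_ereal_inf_tmp => _ [s s0 <-]; apply: le_ereal_sup_tmp.
  pose z := swap_point p p_gt0 s [:: 0%N].
  exists (dual_dist (phi z) (phi z))%:E; last by rewrite lee_fin op_norm_ge0.
  exists (z, z) => //=; exact: (swap_point_dist_le p p_gt0 s [::] [::]).
case: om ka_om => [c ka_om c0|_ _|//]; last by rewrite invey mule0 lee_fin.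
(* If [omega] is 0, then [kappa] is at most 0, and multiplying it by +oo still gives at most 0. *)
have [c00|c_neq0] := eqVneq c 0.
  rewrite c00 mule0 in ka_om; rewrite c00 inve0.
  by apply: le_trans (_ : 0 <= _)%E => //; apply: mule_le0_ge0.
by rewrite inver (negbTE c_neq0) lee_pdivrMr// lt_neqAle eq_sym c_neq0 -lee_fin.
Qed.
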